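(* Let $\mathcal{A} \in \mathbb{C}^{I_1 \times \cdots \times I_M \times J_1 \times \cdots \times J_N}$ have a full rank decomposition $\mathcal{A}=\mathcal{F}*_R\mathcal{G}$, where $\mathcal{F} \in \mathbb{C}^{I_1 \times \cdots \times I_M \times H_1 \times \cdots \times H_R}$ is left invertible, $\mathcal{G} \in \mathbb{C}^{H_1 \times \cdots \times H_R \times J_1 \times \cdots \times J_N}$ is right invertible, and $\mathrm{rshrank}(\mathcal{F})=\mathrm{rshrank}(\mathcal{G})=\mathrm{rshrank}(\mathcal{A})=H_1\cdots H_R$. Let $\mathcal{M} \in \mathbb{C}^{I_1\times\cdots\times I_M \times I_1 \times\cdots\times I_M}$ and $\mathcal{N} \in \mathbb{C}^{J_1\times\cdots\times J_N \times J_1 \times\cdots\times J_N}$ be Hermitian positive definite tensors. Then the weighted Moore-Penrose inverse of $\mathcal{A}$ can be written as $$\mathcal{A}^\dagger_{\mathcal{M},\mathcal{N}} = \mathcal{N}^{-1}*_N \mathcal{G}^* *_R (\mathcal{F}^* *_M \mathcal{M} *_M \mathcal{A} *_N\mathcal{N}^{-1}*_N \mathcal{G}^* )^{-1} *_R \mathcal{F}^* *_M \mathcal{M}.$$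
   Context: Einstein product: for $\mathcal{A}\in\mathbb{C}^{I_1\times\cdots\times I_M\times J_1\times\cdots\times J_N}$ and $\mathcal{B}\in\mathbb{C}^{J_1\times\cdots\times J_N\times K_1\times\cdots\times K_L}$, $(\mathcal{A}*_N\mathcal{B})_{i_1\ldots i_Mk_1\ldots k_L}=\sum_{j_1,\ldots,j_N}a_{i_1\ldots i_Mj_1\ldots j_N}b_{j_1\ldots j_Nk_1\ldots k_L}$ (the subscript is the number of contracted indices; similarly $*_M,*_R$). The conjugate transpose $\mathcal{A}^*$ has entries $(\mathcal{A}^* )_{j_1\ldots j_Ni_1\ldots i_M}=\overline{a_{i_1\ldots i_Mj_1\ldots j_N}}$. Identity tensors have entries equal to products of Kronecker deltas; $\mathcal{I}_R$ is the identity tensor of $\mathbb{C}^{H_1\times\cdots\times H_R\times H_1\times\cdots\times H_R}$. Inverses of tensors with the same row and column index sets are with respect to the Einstein product. $\mathcal{F}$ is left invertible if $\mathcal{Z}*_M\mathcal{F}=\mathcal{I}_R$ for some $\mathcal{Z}$; $\mathcal{G}$ is right invertible if $\mathcal{G}*_N\mathcal{Z}=\mathcal{I}_R$ for some $\mathcal{Z}$. $\mathrm{rshrank}(\mathcal{A})$ is the rank of the $(I_1\cdots I_M)\times(J_1\cdots J_N)$ matrix obtained by flattening the row indices to $i_1+\sum_{k=2}^{M}(i_k-1)\prod_{l<k}I_l$ and the column indices to $j_1+\sum_{k=2}^{N}(j_k-1)\prod_{l<k}J_l$. A tensor $\mathcal{P}$ with the same row and column index sets is Hermitian positive definite if $\mathcal{P}=\mathcal{Z}*\mathcal{D}*\mathcal{Z}^*$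 (Einstein products over all the row indices) with $\mathcal{Z}$ unitary ($\mathcal{Z}*\mathcal{Z}^*=\mathcal{Z}^**\mathcal{Z}$ is the identity tensor) and $\mathcal{D}$ a diagonal tensor with positive diagonal entries. The weighted Moore-Penrose inverse $\mathcal{A}^\dagger_{\mathcal{M},\mathcal{N}}$ is the unique $\mathcal{Y}\in\mathbb{C}^{J_1\times\cdots\times J_N\times I_1\times\cdots\times I_M}$ with $\mathcal{A}*_N\mathcal{Y}*_M\mathcal{A}=\mathcal{A}$, $\mathcal{Y}*_M\mathcal{A}*_N\mathcal{Y}=\mathcal{Y}$, $(\mathcal{M}*_M\mathcal{A}*_N\mathcal{Y})^*=\mathcal{M}*_M\mathcal{A}*_N\mathcal{Y}$, $(\mathcal{N}*_N\mathcal{Y}*_M\mathcal{A})^*=\mathcal{N}*_N\mathcal{Y}*_M\mathcal{A}$. *)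

(* Defs.v *)
From HB Require Import structures.
From mathcomp Require Import all_boot all_order all_algebra.
From mathcomp Require Import complex.
From mathcomp Require Import boolp classical_sets reals.

Set Implicit Arguments.
Unset Strict Implicit.
Unset Printing Implicit Defensive.

Import Order.TTheory GRing.Theory Num.Theory.

Local Open Scope ring_scope.

(* Multi-indices of shape I_1 x ... x I_m, with 0-based components. *)
Definition mindex (m : nat) (I : 'I_m -> nat) : Type :=
  {dffun forall k : 'I_m, 'I_(I k)}.

HB.instance Definition _ (m : nat) (I : 'I_m -> nat) :=
  Finite.copy (mindex I) {dffun forall k : 'I_m, 'I_(I k)}.

(* The flattening i_1 + \sum_(k >= 2) (i_k - 1) \prod_(l < k) I_l, shifted to
   0-based indices. *)
Definition flatn (m : nat) (I : 'I_m -> nat) (i : forall k, 'I_(I k)) : nat :=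
  (\sum_(k < m) i k * \prod_(l < m | (l < k)%N) I l)%N.

Lemma flatn_recl (m : nat) (I : 'I_m.+1 -> nat) (i : forall k, 'I_(I k)) :
  flatn i = (i ord0 + I ord0 * flatn (fun k => i (lift ord0 k)))%N.
Proof.
rewrite /flatn big_ord_recl [X in (_ * X)%N]big_pred0 ?muln1 //.
congr (_ + _)%N; rewrite big_distrr; apply: eq_bigr => k _ /=.
by rewrite big_mkcond big_ord_recl -big_mkcond /= mulnCA.
Qed.

Lemma ltn_flatn (m : nat) (I : 'I_m -> nat) (i : forall k, 'I_(I k)) :
  (flatn i < \prod_(k < m) I k)%N.
Proof.
elim: m I i => [|m IHm] I i; first by rewrite /flatn !big_ord0.
rewrite flatn_recl big_ord_recl.
apply: leq_trans (_ : I ord0 * (flatn (fun k => i (lift ord0 k))).+1 <= _)%N.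
  by rewrite mulnS ltn_add2r ltn_ord.
by rewrite leq_mul2l IHm orbT.
Qed.

Definition flat (m : nat) (I : 'I_m -> nat) (i : mindex I) :
  'I_(\prod_(k < m) I k) := Ordinal (ltn_flatn i).

Lemma flatn_inj (m : nat) (I : 'I_m -> nat) (i j : forall k, 'I_(I k)) :
  flatn i = flatn j -> forall k, i k = j k.
Proof.
elim: m I i j => [|m IHm] I i j; first by move=> _ [].
rewrite !flatn_recl => eqij.
have I0 : (0 < I ord0)%N by apply: leq_ltn_trans (ltn_ord (i ord0)).
have e0 : i ord0 = j ord0.
  apply: val_inj => /=; move/(congr1 (modn^~ (I ord0))): eqij.
  by rewrite ![(I ord0 * _)%N]mulnC ![(nat_of_ord _ + _)%N]addnC !modnMDl
             !modn_small.
move: eqij; rewrite e0 => /addnI/eqP; rewrite eqn_pmul2l // => /eqP/IHm eS k.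
by case: (unliftP ord0 k) => [k'|] ->; [exact: eS|].
Qed.

Lemma flat_inj (m : nat) (I : 'I_m -> nat) : injective (@flat m I).
Proof. by move=> i j [/flatn_inj eqij]; apply/ffunP. Qed.

Lemma flat_onto (m : nat) (I : 'I_m -> nat) (p : 'I_(\prod_(k < m) I k)) :
  p \in codom (@flat m I).
Proof.
apply: inj_card_onto; first exact: flat_inj.
rewrite card_ord card_dep_ffun foldrE big_map big_enum /=.
by apply: leq_prod => k _; rewrite card_ord.
Qed.

Definition unflat (m : nat) (I : 'I_m -> nat) (p : 'I_(\prod_(k < m) I k)) :
  mindex I := iinv (flat_onto p).

Lemma unflatK (m : nat) (I : 'I_m -> nat) : cancel (@unflat m I) (@flat m I).
Proof. by move=> p; apply: f_iinv. Qed.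

Lemma flatK (m : nat) (I : 'I_m -> nat) : cancel (@flat m I) (@unflat m I).
Proof. by move=> i; apply: flat_inj; rewrite unflatK. Qed.

(* C^{I_1 x ... x I_m x J_1 x ... x J_n}; the split of the indices into row and
   column indices is part of the type. *)
Definition tensor (C : Type) (m n : nat) (I : 'I_m -> nat) (J : 'I_n -> nat) :
  Type := {ffun mindex I * mindex J -> C}.

HB.instance Definition _ (C : choiceType) m n (I : 'I_m -> nat)
  (J : 'I_n -> nat) :=
  Choice.copy (tensor C I J) {ffun mindex I * mindex J -> C}.

Section TensorOperations.
Variable C : numClosedFieldType.

Definition einstein (m n l : nat) (I : 'I_m -> nat) (J : 'I_n -> nat)
    (K : 'I_l -> nat) (A : tensor C I J) (B : tensor C J K) : tensor C I K :=
  [ffun ik => \sum_(j : mindex J) A (ik.1, j) * B (j, ik.2)].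

Definition ctr (m n : nat) (I : 'I_m -> nat) (J : 'I_n -> nat)
    (A : tensor C I J) : tensor C J I :=
  [ffun ji => (A (ji.2, ji.1))^*].

(* i == j compares multi-indices: this is the product of the Kronecker deltas
   of their components. *)
Definition idt (m : nat) (I : 'I_m -> nat) : tensor C I I :=
  [ffun ij => (ij.1 == ij.2)%:R].

Definition zerot (m n : nat) (I : 'I_m -> nat) (J : 'I_n -> nat) :
  tensor C I J := [ffun => 0].

Definition rsh (m n : nat) (I : 'I_m -> nat) (J : 'I_n -> nat)
    (A : tensor C I J) : 'M[C]_(\prod_(k < m) I k, \prod_(k < n) J k) :=
  \matrix_(p, q) A (unflat p, unflat q).

Lemma rsh_flat (m n : nat) (I : 'I_m -> nat) (J : 'I_n -> nat)
    (A : tensor C I J) (i : mindex I) (j : mindex J) :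
  rsh A (flat i) (flat j) = A (i, j).
Proof. by rewrite mxE !flatK. Qed.

Definition rshrank (m n : nat) (I : 'I_m -> nat) (J : 'I_n -> nat)
    (A : tensor C I J) : nat := \rank (rsh A).

End TensorOperations.

Arguments idt {C m} I.
Arguments zerot {C m n} I J.

Declare Scope tensor_scope.
Delimit Scope tensor_scope with tens.
Notation "A *e B" := (einstein A B)
  (at level 40, left associativity) : tensor_scope.

Section TensorPredicates.
Variable C : numClosedFieldType.
Local Open Scope tensor_scope.

Definition left_invertible (m n : nat) (I : 'I_m -> nat) (J : 'I_n -> nat)
    (A : tensor C I J) : Prop := exists Z : tensor C J I, Z *e A = idt J.

Definition right_invertible (m n : nat) (I : 'I_m -> nat) (J : 'I_n -> nat)
    (A : tensor C I J) : Prop := exists Z : tensor C J I, A *e Z = idt I.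

Definition is_inverse (m : nat) (I : 'I_m -> nat) (A Y : tensor C I I) : Prop :=
  A *e Y = idt I /\ Y *e A = idt I.

Definition invertible (m : nat) (I : 'I_m -> nat) (A : tensor C I I) : Prop :=
  exists Y, is_inverse A Y.

(* Meaningful only if A is invertible; A itself otherwise. *)
Definition invt (m : nat) (I : 'I_m -> nat) (A : tensor C I I) : tensor C I I :=
  xget A (is_inverse A).

Definition unitary (m : nat) (I : 'I_m -> nat) (Z : tensor C I I) : Prop :=
  Z *e ctr Z = idt I /\ ctr Z *e Z = idt I.

Definition diagonal (m : nat) (I : 'I_m -> nat) (D : tensor C I I) : Prop :=
  forall i j : mindex I, i != j -> D (i, j) = 0.

(* In C, 0 < z means that z is real and positive. *)
Definition hermitian_posdef (m : nat) (I : 'I_m -> nat) (P : tensor C I I) :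
    Prop :=
  exists Z D : tensor C I I,
    [/\ unitary Z, diagonal D, forall i, 0 < D (i, i) & P = Z *e D *e ctr Z].

Definition is_wmp (m n : nat) (I : 'I_m -> nat) (J : 'I_n -> nat)
    (M : tensor C I I) (N : tensor C J J) (A : tensor C I J)
    (Y : tensor C J I) : Prop :=
  [/\ A *e Y *e A = A,
      Y *e A *e Y = Y,
      ctr (M *e A *e Y) = M *e A *e Y
    & ctr (N *e Y *e A) = N *e Y *e A].

(* Meaningful only if is_wmp M N A has a unique solution. *)
Definition wmp (m n : nat) (I : 'I_m -> nat) (J : 'I_n -> nat)
    (M : tensor C I I) (N : tensor C J J) (A : tensor C I J) : tensor C J I :=
  xget (zerot J I) (is_wmp M N A).

End TensorPredicates.

(* Main.v *)
(* Writing M = S^* S with S invertible shows that F^* M F and G N^-1 G^* are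
   Gram tensors of left invertible tensors, hence invertible, and their product
   is F^* M A N^-1 G^*.  With U = F^* M F and V = G N^-1 G^*, the proposed
   inverse X satisfies A X = F U^-1 F^* M and X A = N^-1 G^* V^-1 G, from which
   the four equations are read off. *)
Require Import Defs.
From mathcomp Require Import all_boot all_order all_algebra.
From mathcomp Require Import complex.
From mathcomp Require Import reals.
From mathcomp Require classical_sets.

Local Open Scope ring_scope.
Local Open Scope complex_scope.
Local Open Scope tensor_scope.

Section EinsteinAlgebra.
Import Order.TTheory GRing.Theory Num.Theory.
Context {C : numClosedFieldType}.

(** * Category laws and conjugate transpose for the Einstein product *)

Lemma einsteinA {m n l p : nat} {I : 'I_m -> nat} {J : 'I_n -> nat}
    {K : 'I_l -> nat} {L : 'I_p -> nat} (A : tensor C I J) (B : tensor C J K)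
    (D : tensor C K L) : A *e (B *e D) = A *e B *e D.
Proof.
apply/ffunP => -[i j]; rewrite !ffunE /=.
under eq_bigr do rewrite ffunE big_distrr /=.
under [RHS]eq_bigr do rewrite ffunE big_distrl /=.
rewrite exchange_big /=; apply: eq_bigr => k _; apply: eq_bigr => k' _.
by rewrite mulrA.
Qed.

Lemma ein1t {m n : nat} {I : 'I_m -> nat} {J : 'I_n -> nat}
    (A : tensor C I J) : idt I *e A = A.
Proof.
apply/ffunP => -[i j]; rewrite ffunE /= (bigD1 i) //= ffunE eqxx mul1r.
rewrite big1 ?addr0 // => k nki; rewrite ffunE /= eq_sym.
by rewrite (negPf nki) mul0r.
Qed.

Lemma eint1 {m n : nat} {I : 'I_m -> nat} {J : 'I_n -> nat}
    (A : tensor C I J) : A *e idt J = A.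
Proof.
apply/ffunP => -[i j]; rewrite ffunE /= (bigD1 j) //= ffunE eqxx mulr1.
rewrite big1 ?addr0 // => k nkj; rewrite ffunE /=.
by rewrite (negPf nkj) mulr0.
Qed.

Lemma ctrK {m n : nat} {I : 'I_m -> nat} {J : 'I_n -> nat}
    (A : tensor C I J) : ctr (ctr A) = A.
Proof. by apply/ffunP => -[i j]; rewrite !ffunE /= conjCK. Qed.

Lemma ctr_ein {m n l : nat} {I : 'I_m -> nat} {J : 'I_n -> nat}
    {K : 'I_l -> nat} (A : tensor C I J) (B : tensor C J K) :
  ctr (A *e B) = ctr B *e ctr A.
Proof.
apply/ffunP => -[i j]; rewrite !ffunE /= rmorph_sum /=.
by apply: eq_bigr => k _; rewrite !ffunE rmorphM mulrC.
Qed.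

Lemma ctr_idt {m : nat} (I : 'I_m -> nat) : ctr (idt I) = idt I :> tensor C I I.
Proof. by apply/ffunP => -[i j]; rewrite !ffunE /= rmorph_nat eq_sym. Qed.

(** * Flattening as a faithful passage to matrices *)

Lemma rsh_ein {m n l : nat} {I : 'I_m -> nat} {J : 'I_n -> nat}
    {K : 'I_l -> nat} (A : tensor C I J) (B : tensor C J K) :
  rsh (A *e B) = rsh A *m rsh B.
Proof.
apply/matrixP => p q; rewrite !mxE ffunE /=.
rewrite (reindex (@unflat _ J)) /=; last first.
  by exists (@flat _ J) => x _; rewrite ?flatK ?unflatK.
by apply: eq_bigr => k _; rewrite !mxE.
Qed.

Lemma rsh_idt {m : nat} (I : 'I_m -> nat) : rsh (idt I : tensor C I I) = 1%:M.
Proof.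
by apply/matrixP => p q; rewrite !mxE ffunE /= (can_eq (@unflatK _ I)).
Qed.

Lemma rsh_inj {m n : nat} (I : 'I_m -> nat) (J : 'I_n -> nat) :
  injective (@rsh C m n I J).
Proof. by move=> A B eAB; apply/ffunP => -[i j]; rewrite -!rsh_flat eAB. Qed.

Lemma rsh_onto {m n : nat} (I : 'I_m -> nat) (J : 'I_n -> nat)
    (B : 'M[C]_(\prod_(k < m) I k, \prod_(k < n) J k)) :
  exists A : tensor C I J, rsh A = B.
Proof.
exists [ffun ij => B (flat ij.1) (flat ij.2)].
by apply/matrixP => p q; rewrite mxE ffunE /= !unflatK.
Qed.

Lemma rsh_ctr {m n : nat} {I : 'I_m -> nat} {J : 'I_n -> nat}
    (A : tensor C I J) : rsh (ctr A) = (map_mx Num.conj (rsh A))^T.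
Proof. by apply/matrixP => p q; rewrite !mxE ffunE. Qed.

(** * Inverses for the Einstein product *)

Lemma invtP {m : nat} {I : 'I_m -> nat} {A : tensor C I I} :
  invertible A -> is_inverse A (invt A).
Proof. by case=> Y AY; apply: (classical_sets.xgetPex A (ex_intro _ Y AY)). Qed.

(** Uniqueness of inverses: whatever [invt] selects is pinned down by any explicit inverse. *)
Lemma is_inverse_invt {m : nat} {I : 'I_m -> nat} {A Y : tensor C I I} :
  is_inverse A Y -> invt A = Y.
Proof.
move=> [AY YA]; have [_ XA] := invtP (ex_intro _ Y (conj AY YA)).
by rewrite -[LHS]eint1 -AY einsteinA XA ein1t.
Qed.

Lemma is_inverse_ein {m : nat} {I : 'I_m -> nat} {A B X Y : tensor C I I} :
  is_inverse A X -> is_inverse B Y -> is_inverse (A *e B) (Y *e X).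
Proof.
move=> [AX XA] [BY YB]; split.
  by rewrite einsteinA -(einsteinA A) BY eint1.
by rewrite einsteinA -(einsteinA Y) XA eint1.
Qed.

Lemma is_inverse_ctr {m : nat} {I : 'I_m -> nat} {A X : tensor C I I} :
  is_inverse A X -> is_inverse (ctr A) (ctr X).
Proof. by move=> [AX XA]; split; rewrite -ctr_ein ?AX ?XA ctr_idt. Qed.

Lemma left_invertible_ein {m n l : nat} {I : 'I_m -> nat} {J : 'I_n -> nat}
    {K : 'I_l -> nat} {A : tensor C I J} {B : tensor C J K} :
  left_invertible A -> left_invertible B -> left_invertible (A *e B).
Proof.
move=> [X XA] [Y YB]; exists (Y *e X).
by rewrite einsteinA -(einsteinA Y) XA eint1.
Qed.

(** * Gram tensors and positive definiteness *)

(** The only entry of the product is the sum of the [|v_i|^2], and nonnegative terms with zero sum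
    all vanish. *)
Lemma mulmx_ctr_eq0 (q : nat) (v : 'rV[C]_q) :
  v *m (map_mx Num.conj v)^T = 0 -> v = 0.
Proof.
move/matrixP/(_ ord0 ord0); rewrite !mxE => /eqP.
under eq_bigr do rewrite !mxE -normCK.
rewrite psumr_eq0 => [/allP v0|i _]; last exact: exprn_ge0.
apply/rowP => i; rewrite mxE; apply/eqP; have := v0 i (mem_index_enum i).
by rewrite expf_eq0 normr_eq0.
Qed.

Lemma gram_invertible {m n : nat} {I : 'I_m -> nat} {J : 'I_n -> nat}
    {B : tensor C I J} : left_invertible B -> invertible (ctr B *e B).
Proof.
move=> [Z ZB]; have uK : rsh (ctr B *e B) \in unitmx.
  rewrite -row_free_unit -kermx_eq0; apply/eqP/row_matrixP => i.
  rewrite row0; set v := row i _.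
  have vK : v *m rsh (ctr B *e B) = 0.
    by apply: sub_kermxP; apply: row_sub.
  have vB0 : v *m rsh (ctr B) = 0.
    apply: mulmx_ctr_eq0; rewrite map_mxM trmx_mul /= -rsh_ctr ctrK.
    by rewrite mulmxA -(mulmxA v) -rsh_ein vK mul0mx.
  rewrite -[v]mulmx1 -rsh_idt -ctr_idt -ZB ctr_ein rsh_ein mulmxA vB0.
  by rewrite mul0mx.
have [Y eY] := rsh_onto J J (invmx (rsh (ctr B *e B))).
by exists Y; split; apply: rsh_inj; rewrite rsh_ein rsh_idt eY ?mulmxV ?mulVmx.
Qed.

(** From [P = Z D Z^*], take [S = D^(1/2) Z^*], with inverse [Z D^(-1/2)]. *)
Lemma posdef_gram {m : nat} {I : 'I_m -> nat} {P : tensor C I I} :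
  hermitian_posdef P -> exists2 S, invertible S & P = ctr S *e S.
Proof.
move=> [Z [D [[ZZc ZcZ] Ddiag Dpos ->]]].
(* Functional calculus on [D]: [f] is applied to the diagonal entries, and products of functions
   become Einstein products. *)
pose dg f : tensor C I I :=
  [ffun ij => if ij.1 == ij.2 then f (D (ij.1, ij.1)) else 0].
have dgM f g : dg f *e dg g = dg (fun x => f x * g x).
  apply/ffunP => -[i j]; rewrite !ffunE /= (bigD1 i) //= !ffunE eqxx /=.
  rewrite big1 ?addr0 => [|k nki]; first by case: eqP => _; rewrite ?mulr0.
  by rewrite ffunE /= eq_sym (negPf nki) mul0r.
have dg1 f : (forall i, f (D (i, i)) = 1) -> dg f = idt I.
  by move=> f1; apply/ffunP => -[i j]; rewrite !ffunE /= f1; case: eqP.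
have s0 i : sqrtC (D (i, i)) != 0 by rewrite sqrtC_eq0 gt_eqF.
exists (dg sqrtC *e ctr Z).
  exists (Z *e dg (fun x => (sqrtC x)^-1)); apply: is_inverse_ein.
    by split; rewrite dgM; apply: dg1 => i; rewrite ?mulfV ?mulVf.
  by split.
(* Square roots of positive numbers are real, so [D^(1/2)] is Hermitian. *)
have dgc : ctr (dg sqrtC) = dg sqrtC.
  apply/ffunP => -[i j]; rewrite !ffunE /= eq_sym.
  case: eqP => [->|_]; last exact: rmorph0.
  by apply: CrealP; rewrite ger0_real // sqrtC_ge0 ltW.
rewrite ctr_ein ctrK dgc einsteinA -(einsteinA Z (dg _)) dgM.
congr (_ *e _ *e _); apply/ffunP => -[i j]; rewrite ffunE /=.
by case: eqP => [->|/eqP/Ddiag ->] //; rewrite -expr2 sqrtCK.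
Qed.

Lemma posdef_ctr {m : nat} {I : 'I_m -> nat} {P : tensor C I I} :
  hermitian_posdef P -> ctr P = P.
Proof. by move=> /posdef_gram[S _ ->]; rewrite ctr_ein ctrK. Qed.

Lemma posdef_invertible {m : nat} {I : 'I_m -> nat} {P : tensor C I I} :
  hermitian_posdef P -> invertible P.
Proof.
move=> /posdef_gram[S [T [ST TS]] ->].
by apply: gram_invertible; exists T.
Qed.

Lemma ctr_invt {m : nat} {I : 'I_m -> nat} {A : tensor C I I} :
  invertible A -> ctr A = A -> ctr (invt A) = invt A.
Proof.
by move=> /invtP/is_inverse_ctr + Ac; rewrite Ac => /is_inverse_invt.
Qed.

(** With [P = S^* S], this is the Gram tensor of [S B], which is left invertible. *)
Lemma posdef_congr_invertible {m n : nat} {I : 'I_m -> nat} {J : 'I_n -> nat}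
    {P : tensor C I I} {B : tensor C I J} :
  hermitian_posdef P -> left_invertible B -> invertible (ctr B *e P *e B).
Proof.
move=> /posdef_gram[S [T [_ TS]] ->] linvB.
rewrite !einsteinA -ctr_ein -einsteinA; apply/gram_invertible.
by apply: left_invertible_ein => //; exists T.
Qed.

(** With [P = S^* S] and [T = S^-1], the inverse of [P] is [T T^*], so this is the Gram tensor of
    [T^* B]; [S^*] is a left inverse of [T^*]. *)
Lemma posdef_congr_invt_invertible {m n : nat} {I : 'I_m -> nat}
    {J : 'I_n -> nat} {P : tensor C I I} {B : tensor C I J} :
  hermitian_posdef P -> left_invertible B ->
  invertible (ctr B *e invt P *e B).
Proof.
move=> /posdef_gram[S [T [ST TS]] ->] linvB.
have iS : is_inverse S T by split.
rewrite (is_inverse_invt (is_inverse_ein (is_inverse_ctr iS) iS)).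
rewrite -{1}[T]ctrK !einsteinA -ctr_ein -einsteinA; apply/gram_invertible.
apply: left_invertible_ein => //; exists (ctr S).
by rewrite -ctr_ein TS ctr_idt.
Qed.

(** * Uniqueness of the weighted inverse *)

Lemma ein_cancel_left {m n : nat} {I : 'I_m -> nat} {J : 'I_n -> nat}
    {M : tensor C I I} {X Y : tensor C I J} :
  invertible M -> M *e X = M *e Y -> X = Y.
Proof.
move=> [M' [_ M'M]] eXY.
by rewrite -[X]ein1t -[Y]ein1t -M'M -!einsteinA eXY.
Qed.

(** The hypotheses read [M P = P^* M] and [M Q = Q^* M]: moving [M] rightwards past both factors
    reverses their order. *)
Lemma weighted_hermitian_ein {m : nat} {I : 'I_m -> nat}
    {M P Q : tensor C I I} :
  ctr M = M -> ctr (M *e P) = M *e P -> ctr (M *e Q) = M *e Q ->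
  M *e (P *e Q) = ctr (Q *e P) *e M.
Proof.
rewrite !ctr_ein => -> MP MQ.
by rewrite einsteinA -MP -!einsteinA -MQ.
Qed.

(* M (A X) = M (A Y) because A X and A Y are M-self-adjoint projections onto
   the same range; likewise X A and Y A are N-self-adjoint projections with the
   same kernel.  Hence X = X A X = Y A X = Y A Y = Y. *)
Lemma wmp_unique {m n : nat} {I : 'I_m -> nat} {J : 'I_n -> nat}
    {M : tensor C I I} {N : tensor C J J} {A : tensor C I J}
    {X Y : tensor C J I} :
  invertible M -> ctr M = M -> invertible N -> ctr N = N ->
  is_wmp M N A X -> is_wmp M N A Y -> X = Y.
Proof.
move=> iM Mc iN Nc [AX XA MX NX] [AY YA MY NY].
rewrite -!einsteinA in MX MY NX NY.
have eA : A *e X = A *e Y.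
  apply: (ein_cancel_left iM).
  have := weighted_hermitian_ein Mc MY MX.
  rewrite (einsteinA (A *e Y)) AY (einsteinA (A *e X)) AX => ->.
  by rewrite -[RHS]MY (ctr_ein M) Mc.
have eX : X *e A = Y *e A.
  apply: (ein_cancel_left iN).
  (* Here [X A Y A = X A], whereas on the range side it was [A Y A X = A X]; hence [X] and [Y] trade
     places. *)
  have := weighted_hermitian_ein Nc NX NY.
  rewrite -(einsteinA X A) (einsteinA A Y) AY.
  rewrite -(einsteinA Y A) (einsteinA A X) AX => ->.
  by rewrite -[RHS]NY (ctr_ein N) Nc.
by rewrite -XA eX -einsteinA eA einsteinA YA.
Qed.

End EinsteinAlgebra.

Theorem theorem10 (R : realType) (m n r : nat)
    (I : 'I_m -> nat) (J : 'I_n -> nat) (H : 'I_r -> nat)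
    (A : tensor R[i] I J) (F : tensor R[i] I H) (G : tensor R[i] H J)
    (M : tensor R[i] I I) (N : tensor R[i] J J)
    (A_FG : A = F *e G)
    (F_linv : left_invertible F)
    (G_rinv : right_invertible G)
    (rankF : rshrank F = (\prod_(k < r) H k)%N)
    (rankG : rshrank G = (\prod_(k < r) H k)%N)
    (rankA : rshrank A = (\prod_(k < r) H k)%N)
    (M_posdef : hermitian_posdef M)
    (N_posdef : hermitian_posdef N) :
  [/\ invertible N,
      invertible (ctr F *e M *e A *e invt N *e ctr G),
      exists! Y : tensor R[i] J I, is_wmp M N A Y
    & wmp M N A =
        invt N *e ctr G *e invt (ctr F *e M *e A *e invt N *e ctr G)
          *e ctr F *e M].
Proof.
have iM := posdef_invertible M_posdef; have Mc := posdef_ctr M_posdef.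
have iN := posdef_invertible N_posdef; have Nc := posdef_ctr N_posdef.
have linvGc : left_invertible (ctr G).
  by case: G_rinv => Z GZ; exists (ctr Z); rewrite -ctr_ein GZ ctr_idt.
have iU := posdef_congr_invertible M_posdef F_linv.
have iV := posdef_congr_invt_invertible N_posdef linvGc.
have [NN' N'N] := invtP iN; have N'c := ctr_invt iN Nc.
have Uc : ctr (ctr F *e M *e F) = ctr F *e M *e F.
  by rewrite !ctr_ein ctrK Mc einsteinA.
have Vc : ctr (G *e invt N *e ctr G) = G *e invt N *e ctr G.
  by rewrite !ctr_ein ctrK N'c einsteinA.
rewrite ctrK in iV.
have KUV : ctr F *e M *e A *e invt N *e ctr G
    = (ctr F *e M *e F) *e (G *e invt N *e ctr G) by rewrite A_FG !einsteinA.
(* The inverse of the product is [V^-1 U^-1], and it replaces the opaque [invt] in the goal. *)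
have iUV := is_inverse_ein (invtP iU) (invtP iV).
rewrite KUV (is_inverse_invt iUV).
have [UU' U'U] := invtP iU; have [VV' V'V] := invtP iV.
have U'c := ctr_invt iU Uc; have V'c := ctr_invt iV Vc.
set U' := invt (ctr F *e M *e F) in iUV UU' U'U U'c *.
set V' := invt (G *e invt N *e ctr G) in iUV VV' V'V V'c *.
set X := _ *e _ *e _ *e ctr F *e M.
(* The factor [G N^-1 G^*] appears next to [V^-1] and cancels. *)
have AX : A *e X = F *e U' *e ctr F *e M.
  by rewrite /X A_FG !einsteinA -(einsteinA F G) -2!(einsteinA F) VV' eint1.
(* The factor [F^* M F] appears next to [U^-1] and cancels. *)
have XA : X *e A = invt N *e ctr G *e V' *e G.
  rewrite /X A_FG !einsteinA -(einsteinA _ (ctr F) M) -(einsteinA _ _ F).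
  by rewrite -(einsteinA _ U') U'U eint1.
have wX : is_wmp M N A X.
  split.
  - rewrite AX A_FG einsteinA -(einsteinA _ (ctr F) M) -(einsteinA _ _ F).
    by rewrite -(einsteinA F) U'U eint1.
  - rewrite XA /X !einsteinA -(einsteinA _ G) -(einsteinA _ _ (ctr G)).
    by rewrite -(einsteinA _ V' (G *e _ *e _)) V'V eint1.
  (* [M A X = M F U^-1 F^* M] is Hermitian because [U^-1] and [M] are. *)
  - by rewrite -einsteinA AX !ctr_ein U'c Mc ctrK !einsteinA.
  (* [N] cancels [N^-1], leaving the Hermitian tensor [G^* V^-1 G]. *)
  - by rewrite -einsteinA XA !einsteinA NN' ein1t !ctr_ein V'c ctrK einsteinA.
have uX Y : is_wmp M N A Y -> X = Y by apply: wmp_unique.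
split=> //; [by exists (V' *e U')|by exists X|].
(* Either [xget] returns a solution, equal to [X] by uniqueness, or no solution exists, which [X]
   refutes. *)
by rewrite /wmp; case: classical_sets.xgetP => [Y _ /uX|/(_ X)].
Qed.
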